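(* For every triangle-free graph $G$, $\varphi(G) \geq \hat{\varphi}(G) \geq \psi(G)-2$.
   Context: All graphs are finite, simple and undirected, with at least one vertex. $\chi$ denotes the chromatic number. For a proper vertex coloring $c$ of $G$ and an induced subgraph $H$ of $G$, let $c(H)$ be the set of colors used by $c$ on the vertices of $H$. Define $\varphi_c(G)=\max_{H}\,(|c(H)|-\chi(H))$ over all induced subgraphs $H$ of $G$, and $\hat{\varphi}_c(G)$ as the same maximum taken only over all connected induced subgraphs $H$ of $G$. Define $\varphi(G)=\min_c \varphi_c(G)$ and $\hat{\varphi}(G)=\min_c \hat{\varphi}_c(G)$, the minima over all proper colorings $c$ of $G$ (with any number of colors). The local chromatic number $\psi(G)$ is the minimum, over all proper colorings $c$ of $G$, of the maximum over vertices $v$ of the number of colors used by $c$ on the closed neighborhood of $v$. *)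

(* Defs.v *)
From mathcomp Require Import all_boot.
From mathcomp Require Import boolp.
Set Implicit Arguments.
Unset Strict Implicit.
Unset Printing Implicit Defensive.

(* The empty graph is allowed here so that [induced] is total; theorems about
   graphs with at least one vertex assume [0 < #|G|]. *)
Record sgraph := SGraph {
  vertex :> finType;
  edge : rel vertex;
  edge_sym : symmetric edge;
  edge_irrefl : irreflexive edge }.

Arguments edge {G} : rename.

Lemma induced_sym (G : sgraph) (H : {set G}) :
  symmetric (fun x y : {x : G | x \in H} => edge (val x) (val y)).
Proof. by move=> x y; apply: edge_sym. Qed.

Lemma induced_irrefl (G : sgraph) (H : {set G}) :
  irreflexive (fun x y : {x : G | x \in H} => edge (val x) (val y)).
Proof. by move=> x; apply: edge_irrefl. Qed.

Definition induced (G : sgraph) (H : {set G}) : sgraph :=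
  SGraph (@induced_sym G H) (@induced_irrefl G H).

Definition connected (G : sgraph) : bool :=
  (0 < #|G|) && [forall x : G, forall y : G, connect edge x y].

Definition triangle_free (G : sgraph) : Prop :=
  forall x y z : G, ~~ [&& edge x y, edge y z & edge z x].

Definition proper (G : sgraph) (k : nat) (c : {ffun G -> 'I_k}) : bool :=
  [forall x : G, forall y : G, edge x y ==> (c x != c y)].

Lemma proper_ex (G : sgraph) :
  exists k, [exists c : {ffun G -> 'I_k}, proper c].
Proof.
exists #|G|; apply/existsP; exists [ffun x => enum_rank x].
apply/forallP => x; apply/forallP => y; apply/implyP => exy; rewrite !ffunE.
by apply: contraTneq exy => /enum_rank_inj ->; rewrite edge_irrefl.
Qed.

Definition chi (G : sgraph) : nat := ex_minn (proper_ex G).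

Lemma min_coloring_ex (G : sgraph) (f : forall k, {ffun G -> 'I_k} -> nat) :
  exists n, `[< exists k (c : {ffun G -> 'I_k}), proper c /\ f k c = n >].
Proof.
have [k /existsP[c cP]] := proper_ex G.
by exists (f k c); apply/asboolP; exists k, c.
Qed.

(* Minimum of [f c] over all proper colorings [c], the number [k] of available
   colors being unrestricted. *)
Definition min_coloring (G : sgraph) (f : forall k, {ffun G -> 'I_k} -> nat) :
  nat := ex_minn (min_coloring_ex f).

(* For a proper coloring the truncated subtractions in [phi_col] and
   [phi_hat_col] are genuine ones. *)
Lemma chi_induced_le (G : sgraph) (k : nat) (c : {ffun G -> 'I_k})
    (H : {set G}) : proper c -> chi (induced H) <= #|c @: H|.
Proof.
move=> cP; rewrite /chi; case: ex_minnP => m _; apply; apply/existsP.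
have cin (x : induced H) : c (val x) \in c @: H by apply/imset_f/(valP x).
exists [ffun x => enum_rank_in (cin x) (c (val x))].
apply/forallP => x; apply/forallP => y; apply/implyP => exy; rewrite !ffunE.
apply/eqP => /(congr1 enum_val); rewrite !enum_rankK_in // => cxy.
move/forallP/(_ (val x))/forallP/(_ (val y))/implyP/(_ exy): cP.
by rewrite cxy eqxx.
Qed.

Definition phi_col (G : sgraph) (k : nat) (c : {ffun G -> 'I_k}) : nat :=
  \max_(H : {set G} | H != set0) (#|c @: H| - chi (induced H)).

Definition phi_hat_col (G : sgraph) (k : nat) (c : {ffun G -> 'I_k}) : nat :=
  \max_(H : {set G} | connected (induced H)) (#|c @: H| - chi (induced H)).

Definition phi (G : sgraph) : nat := min_coloring (@phi_col G).

Definition phi_hat (G : sgraph) : nat := min_coloring (@phi_hat_col G).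

Definition closed_nbhd (G : sgraph) (v : G) : {set G} :=
  [set w | (w == v) || edge v w].

Definition psi (G : sgraph) : nat :=
  min_coloring
    (fun k (c : {ffun G -> 'I_k}) => \max_(v : G) #|c @: closed_nbhd v|).

(* Main.v *)
Require Import Defs.
From mathcomp Require Import all_boot all_order all_algebra.
From mathcomp Require Import boolp zify.

(** In a triangle-free graph a closed neighborhood induces a star, which is
    connected and 2-colorable; testing [phi_hat_col c] on closed neighborhoods
    therefore loses at most 2 against the local number of colors of [c]. *)

(** A coloring that minimizes [g] is a candidate for [f], so a bound with slack [d] valid for each
    proper coloring passes to the minima. *)
Lemma min_coloring_leD (G : sgraph) (f g : forall k, {ffun G -> 'I_k} -> nat)
    (d : nat) :
  (forall k (c : {ffun G -> 'I_k}), Defs.proper c -> f k c <= g k c + d) ->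
  min_coloring f <= min_coloring g + d.
Proof.
move=> fg; rewrite /min_coloring.
case: (ex_minnP (min_coloring_ex g)) => _ /asboolP[k [c [cP <-]]] _.
case: ex_minnP => m _ m_min; apply: leq_trans (fg k c cP).
by apply: m_min; apply/asboolP; exists k, c.
Qed.

(** Makes every set tested by [phi_hat_col] admissible in [phi_col]. *)
Lemma connected_induced_neq0 (G : sgraph) (H : {set G}) :
  connected (induced H) -> H != set0.
Proof.
by case/andP=> /card_gt0P[x _] _; apply/set0Pn; exists (val x); apply: valP.
Qed.

Lemma phi_hat_col_le (G : sgraph) (k : nat) (c : {ffun G -> 'I_k}) :
  phi_hat_col c <= phi_col c.
Proof.
apply/bigmax_leqP => H /connected_induced_neq0 H0.
exact: (leq_bigmax_cond (F := fun H : {set G} => #|c @: H| - chi (induced H))).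
Qed.

(** Any two vertices are joined through the center [v]. *)
Lemma connected_closed_nbhd (G : sgraph) (v : G) :
  connected (induced (closed_nbhd v)).
Proof.
have vN : v \in closed_nbhd v by rewrite inE eqxx.
pose v' : induced (closed_nbhd v) := Sub v vN.
have v'_to y : connect edge v' y.
  have := valP y; rewrite inE => /orP[/eqP yv|vy]; last exact: connect1.
  by rewrite (_ : y = v') //; apply: val_inj.
apply/andP; split; first by apply/card_gt0P; exists v'.
apply/forallP => x; apply/forallP => y; apply: connect_trans (v'_to y).
by rewrite (sym_connect_sym (@edge_sym _)) v'_to.
Qed.

Lemma chi_closed_nbhd (G : sgraph) (v : G) :
  triangle_free G -> chi (induced (closed_nbhd v)) <= 2.
Proof.
move=> tf; rewrite /chi; case: ex_minnP => m _; apply; apply/existsP.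
(* The center gets one color, all its neighbors the other. *)
exists [ffun x => if val x == v then ord0 else ord_max].
apply/forallP => x; apply/forallP => y; apply/implyP => /= exy; rewrite !ffunE.
have := valP x; have := valP y; rewrite !inE.
(* An edge with equally colored ends would be a loop at [v] or would join two neighbors of [v],
   closing a triangle. *)
case: eqP => [yv|_] /=; case: eqP => [xv|_] //= vy vx.
  by move: exy; rewrite xv yv edge_irrefl.
by have := tf v (val x) (val y); rewrite vx exy edge_sym vy.
Qed.

Lemma closed_nbhd_colors_le (G : sgraph) (k : nat) (c : {ffun G -> 'I_k}) :
  triangle_free G -> \max_(v : G) #|c @: closed_nbhd v| <= phi_hat_col c + 2.
Proof.
move=> tf; apply/bigmax_leqP => v _; rewrite addnC -leq_subLR.
(* Subtracting the chromatic number, at most 2, instead of 2 can only increase the difference and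
   gives a term of the maximum. *)
apply: leq_trans (leq_sub2l _ (chi_closed_nbhd _ v tf)) _.
exact: (leq_bigmax_cond (F := fun H : {set G} => #|c @: H| - chi (induced H)))
  (connected_closed_nbhd _ v).
Qed.

Theorem proposition4p7 (G : sgraph) (G_nonempty : 0 < #|G|)
    (G_triangle_free : triangle_free G) :
  phi_hat G <= phi G /\
  (((psi G)%:Z - 2%:Z)%R <= (phi_hat G)%:Z)%R.
Proof.
split.
  rewrite -[phi G]addn0; apply: min_coloring_leD => k c _.
  by rewrite addn0 phi_hat_col_le.
suff: psi G <= phi_hat G + 2 by lia.
by apply: min_coloring_leD => k c _; apply: closed_nbhd_colors_le.
Qed.
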